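(* Let $q=ef+1$ be a prime power, with $e,f>1$, and let $\epsilon>1$ be a proper divisor of $e$ (so $e>\epsilon$). Suppose $C_0^\epsilon$ is a $(q,\frac{q-1}{\epsilon},\lambda)$-difference set (here $\lambda=\frac{q-1-\epsilon}{\epsilon^2}$), and let ${C_0^\epsilon}'=\{C_0^e,C_\epsilon^e,\ldots,C_{e-\epsilon}^e\}$. (i) If $\phi_i\neq\phi_j$ for some distinct $i,j\in\{1,\ldots,\epsilon-1\}$, then ${C_0^\epsilon}'$ is neither a disjoint partial difference family nor an external partial difference family. (ii) Otherwise, ${C_0^\epsilon}'$ is a $(q,\frac{e}{\epsilon},f,\frac{f-1}{\epsilon})$-disjoint difference family and a $(q,\frac{e}{\epsilon},f,\frac{(e-\epsilon)f}{\epsilon^2})$-external difference family. In particular, ${C_0^\epsilon}'$ cannot be a proper disjoint partial difference family nor a proper external partial difference family.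
   Context: $G=(GF(q),+)$, $G^*=G\setminus\{0\}$; $\alpha$ a primitive element; $C_i^d=\alpha^i\langle\alpha^d\rangle$ for $d\mid q-1$. For $0\le i\le\epsilon-1$, $\Phi_i=\{x\in C_0^e:x\neq1,\ x-1\in\alpha^iC_0^\epsilon\}$ and $\phi_i=|\Phi_i|$. $\Delta(D)$ is the multiset $\{x-y:x,y\in D,x\neq y\}$, $\Delta(D_1,D_2)$ the multiset $\{x-y:x\in D_1,y\in D_2\}$, $\lambda A$ is $\lambda$ copies of each element of $A$. $D$ is a $(q,k,\lambda)$-difference set if $|D|=k$ and $\Delta(D)=\lambda G^*$. For a family of $m$ disjoint $k$-subsets $D_i$ of $G^*$ with union $S$: $(q,m,k,\lambda)$-disjoint difference family means $\bigcup_i\Delta(D_i)=\lambda G^*$; $(q,m,k,\lambda)$-external difference family means $\bigcup_{i\neq j}\Delta(D_i,D_j)=\lambda G^*$; disjoint (resp. external) partial difference family means $\bigcup_i\Delta(D_i)$ (resp. $\bigcup_{i\neq j}\Delta(D_i,D_j)$) equals $\lambda S+\mu(G^*\setminus S)$ for some $\lambda,\mu$, proper if $\lambda\neq\mu$. *)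

(* Defs.v *)
From mathcomp Require Import all_boot all_order all_algebra all_field.

Set Implicit Arguments.
Unset Strict Implicit.
Unset Printing Implicit Defensive.

Import GRing.Theory.
Local Open Scope ring_scope.

(* Multisets over F are represented by sequences up to perm_eq; multiset union
   is concatenation. *)
Section Defs.
Variable F : finFieldType.

(* exponents below #|F| exhaust the cyclic group generated by alpha ^+ d *)
Definition cyc_class (alpha : F) (d i : nat) : {set F} :=
  [set alpha ^+ i * (alpha ^+ d) ^+ j | j : 'I_#|F|].

Definition Phi (alpha : F) (e epsilon i : nat) : {set F} :=
  [set x in cyc_class alpha e 0 |
    (x != 1) &&
    (x - 1 \in [set alpha ^+ i * y | y in cyc_class alpha epsilon 0])].

Definition phi (alpha : F) (e epsilon i : nat) : nat :=
  #|Phi alpha e epsilon i|.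

Definition Gstar : {set F} := [set~ 0].

Definition copies (n : nat) (A : {set F}) : seq F := flatten (nseq n (enum A)).

Definition Delta (D : {set F}) : seq F :=
  [seq x - y | x <- enum D, y <- enum (D :\ x)].

Definition Delta2 (D1 D2 : {set F}) : seq F :=
  [seq x - y | x <- enum D1, y <- enum D2].

Definition difference_set (q k lambda : nat) (D : {set F}) : Prop :=
  [/\ #|F| = q, #|D| = k & perm_eq (Delta D) (copies lambda Gstar)].

Definition disjoint_family (q m k : nat) (D : 'I_m -> {set F}) : Prop :=
  [/\ #|F| = q,
      forall i, D i \subset Gstar,
      forall i, #|D i| = k
    & forall i j, i != j -> [disjoint D i & D j]].

Definition family_union m (D : 'I_m -> {set F}) : {set F} :=
  \bigcup_(i < m) D i.

Definition internal_diffs m (D : 'I_m -> {set F}) : seq F :=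
  \big[cat/[::]]_(i < m) Delta (D i).

Definition external_diffs m (D : 'I_m -> {set F}) : seq F :=
  \big[cat/[::]]_(i < m) \big[cat/[::]]_(j < m | i != j) Delta2 (D i) (D j).

Definition disjoint_difference_family (q m k lambda : nat)
    (D : 'I_m -> {set F}) : Prop :=
  disjoint_family q k D /\
  perm_eq (internal_diffs D) (copies lambda Gstar).

Definition external_difference_family (q m k lambda : nat)
    (D : 'I_m -> {set F}) : Prop :=
  disjoint_family q k D /\
  perm_eq (external_diffs D) (copies lambda Gstar).

Definition partial_multiset (lambda mu : nat) (S : {set F}) : seq F :=
  copies lambda S ++ copies mu (Gstar :\: S).

Definition dpdf_with (q m k lambda mu : nat) (D : 'I_m -> {set F}) : Prop :=
  disjoint_family q k D /\
  perm_eq (internal_diffs D) (partial_multiset lambda mu (family_union D)).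

Definition epdf_with (q m k lambda mu : nat) (D : 'I_m -> {set F}) : Prop :=
  disjoint_family q k D /\
  perm_eq (external_diffs D) (partial_multiset lambda mu (family_union D)).

Definition disjoint_partial_difference_family m (D : 'I_m -> {set F}) : Prop :=
  exists k lambda mu, dpdf_with #|F| k lambda mu D.

Definition external_partial_difference_family m (D : 'I_m -> {set F}) : Prop :=
  exists k lambda mu, epdf_with #|F| k lambda mu D.

Definition proper_dpdf m (D : 'I_m -> {set F}) : Prop :=
  exists k lambda mu, lambda <> mu /\ dpdf_with #|F| k lambda mu D.

Definition proper_epdf m (D : 'I_m -> {set F}) : Prop :=
  exists k lambda mu, lambda <> mu /\ epdf_with #|F| k lambda mu D.

(* the partition {C_0^e, C_epsilon^e, ..., C_{e - epsilon}^e} of C_0^epsilon *)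
Definition class_partition (alpha : F) (e epsilon : nat)
    (j : 'I_(e %/ epsilon)) : {set F} :=
  cyc_class alpha e (epsilon * j).

End Defs.

(* Main.v *)
Require Import Defs.
From mathcomp Require Import all_boot all_order all_algebra all_field.
From mathcomp Require Import zify.

(* Write S = C_0^epsilon.  Substituting x = u y shows that a nonzero z in
   alpha^i S occurs exactly phi_i times as an internal difference of the
   partition, hence lambda - phi_i times as an external one.  So a partial
   difference family forces phi_1 = ... = phi_(epsilon - 1), and the point is
   that phi_0 must then have the same value.  Otherwise, internal differences
   being symmetric, S = -S.  But a nontrivial power residue difference set is
   never symmetric: modulo a prime p dividing |S| - lambda, convolutions with
   the dilates of S are commuting operators of square zero on functions of total
   0, so they have a common kernel vector, whereas their sum is -|S|, which is
   nonzero modulo p. *)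

Set Implicit Arguments.
Unset Strict Implicit.
Unset Printing Implicit Defensive.
Import GRing.Theory.
Local Open Scope ring_scope.

(** * Difference multisets described by their multiplicities *)

Lemma perm_eq_count_mem (T : eqType) (s t : seq T) :
  perm_eq s t <-> forall z, count_mem z s = count_mem z t.
Proof.
split=> [/permP st z | st]; first exact: st.
by apply/allP => z _; apply/eqP/st.
Qed.

Section DifferenceCounts.
Variable F : finFieldType.
Implicit Types (D S : {set F}) (z : F).

(** The multiplicity of [z] as [x - y] with [x] in [D1] and [y] in [D2], counted by [y] alone since
    [y] determines [x]. The value [z = 0] is allowed and yields the size of the intersection. *)
Definition diff_count D1 D2 z : nat := #|[set y in D2 | y + z \in D1]|.

Lemma count_mem_copies n S z : count_mem z (copies n S) = (n * (z \in S))%N.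
Proof.
by rewrite /copies count_flatten map_nseq sumn_nseq mulnC count_uniq_mem
  ?enum_uniq // mem_enum.
Qed.

Lemma diff_count_sum D1 D2 z :
  diff_count D1 D2 z = (\sum_(x in D1) \sum_(y in D2) (x - y == z)%R)%N.
Proof.
rewrite exchange_big /= /diff_count -sum1_card.
rewrite (eq_bigl (fun y => (y \in D2) && (y + z \in D1))); last first.
  by move=> y; rewrite inE.
rewrite big_mkcondr; apply: eq_bigr => y _.
under eq_bigr => x _ do rewrite subr_eq addrC.
case: ifP => Dyz; last first.
  by rewrite big1 // => x Dx; case: eqP => // ex; rewrite -ex Dx in Dyz.
by rewrite (bigD1 (y + z)) //= eqxx big1 // => x /andP[_ /negbTE ->].
Qed.

Lemma count_mem_Delta2 D1 D2 z : count_mem z (Delta2 D1 D2) = diff_count D1 D2 z.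
Proof.
rewrite diff_count_sum -sum1_count big_mkcond /= big_allpairs_dep big_enum /=.
apply: eq_bigr => x _; rewrite big_enum /=; apply: eq_bigr => y _.
by case: eqP.
Qed.

(** The factor [z != 0] removes the diagonal pairs: [Delta] discards them, [diff_count] does not. *)
Lemma count_mem_Delta D z :
  count_mem z (Delta D) = ((z != 0)%R * diff_count D D z)%N.
Proof.
rewrite diff_count_sum -sum1_count big_mkcond /= big_allpairs_dep big_enum /=.
rewrite big_distrr; apply: eq_bigr => x Dx; rewrite big_enum /= big_distrr /=.
rewrite [RHS](bigD1 x) //= subrr (eq_sym 0).
have ->: ((z != 0)%R * (z == 0)%R)%N = 0%N by case: eqP.
rewrite add0n; apply: eq_big => y; first by rewrite !inE andbC.
rewrite !inE => /andP[y_x _]; case: eqP => [<-|]; last by rewrite muln0.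
by rewrite muln1 subr_eq0 eq_sym y_x.
Qed.

Lemma count_mem_bigcat (I : finType) (P : pred I) (s : I -> seq F) z :
  count_mem z (\big[cat/[::]]_(i | P i) s i)
  = (\sum_(i | P i) count_mem z (s i))%N.
Proof. by apply: big_morph => // u v; rewrite count_cat. Qed.

Lemma count_mem_partial lambda mu S z : z != 0 ->
  count_mem z (partial_multiset lambda mu S) = if z \in S then lambda else mu.
Proof.
move=> z0; rewrite count_cat !count_mem_copies !inE z0 andbT.
by case: (z \in S); rewrite /= !muln0 !muln1 ?addn0.
Qed.

Lemma diff_count0 D : diff_count D D 0 = #|D|.
Proof. by apply: eq_card => y; rewrite inE addr0 andbb. Qed.

Lemma sum_diff_count D1 D2 :
  (\sum_z diff_count D1 D2 z = #|D1| * #|D2|)%N.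
Proof.
under eq_bigr do rewrite diff_count_sum.
rewrite exchange_big -sum_nat_const; apply: eq_bigr => x _.
rewrite exchange_big -sum1_card; apply: eq_bigr => y _.
rewrite (bigD1 (x - y)) //= eqxx big1 // => z.
by rewrite eq_sym => /negbTE ->.
Qed.

End DifferenceCounts.

(** * Symmetric difference sets and the operators attached to their dilates *)

Section ReversibleDifferenceSets.
Variables (F : finFieldType) (K : fieldType) (S : {set F}).

(** Convolution of [g] with the indicator of [- a S]. The values lie in an arbitrary field [K], so
    that one may reduce modulo a prime. *)
Definition translate_sum (a : F) (g : F -> K) (x : F) : K :=
  \sum_(s in S) g (x + a * s).

Lemma translate_sumC a b g x :
  translate_sum a (translate_sum b g) x = translate_sum b (translate_sum a g) x.
Proof.
rewrite /translate_sum exchange_big; apply: eq_bigr => s _.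
by apply: eq_bigr => t _; rewrite addrAC.
Qed.

Lemma translate_sum_total a g :
  \sum_x translate_sum a g x = #|S|%:R * \sum_x g x.
Proof.
rewrite exchange_big /= mulr_natl -sumr_const; apply: eq_bigr => s _.
by rewrite [RHS](reindex_inj (addIr (a * s))).
Qed.

Lemma translate_sum_all g x :
  \sum_(a | a != 0) translate_sum a g x
  = \sum_(s in S) \sum_(a | a != 0) g (x + a * s).
Proof. exact: exchange_big. Qed.

Variable lambda : nat.
Hypothesis S_neq0 : 0 \notin S.
Hypothesis S_opp : forall x, (- x \in S) = (x \in S).
Hypothesis S_diff : forall z : F, z != 0 -> diff_count S S z = lambda.

(** Squaring sums [g (x + a * (s + t))] over [s, t] in [S]. As [S = -S], the sum [s + t] takes the
    value [z] as often as a difference does: [lambda] times for [z != 0], and [#|S|] times for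
    [z = 0]. *)
Lemma translate_sum_sqr a g x : a != 0 ->
  translate_sum a (translate_sum a g) x
  = lambda%:R * (\sum_y g y) + (#|S|%:R - lambda%:R) * g x.
Proof.
move=> a0.
have -> : translate_sum a (translate_sum a g) x
        = \sum_z (diff_count S S z)%:R * g (x + a * z).
  under [RHS]eq_bigr => z _.
    rewrite diff_count_sum natr_sum mulr_suml.
    under eq_bigr do rewrite natr_sum mulr_suml.
    over.
  rewrite exchange_big; apply: eq_bigr => s _.
  (* Replacing [t] by [- t] turns differences into sums; this is where [S = -S] enters. *)
  rewrite exchange_big /= (reindex_inj (@oppr_inj F)) /=.
  apply: eq_big => [t|t _]; first by rewrite S_opp.
  rewrite opprK (bigD1 (s + t)) //= eqxx mul1r big1 => [|z]; last first.
    by rewrite eq_sym => /negbTE ->; rewrite mul0r.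
  by rewrite addr0 mulrDr addrA.
have -> : \sum_y g y = \sum_z g (x + a * z).
  rewrite (reindex_inj (addrI x)) [LHS](reindex_inj (mulfI a0)).
  by [].
rewrite (bigD1 0) //= diff_count0 [in RHS](bigD1 0) //=.
rewrite mulr0 addr0 mulrDr mulrBl.
under eq_bigr => z z0 do rewrite S_diff //.
by rewrite mulr_sumr [RHS]addrC addrA subrK.
Qed.

(* Modulo a divisor of |S| - lambda the operators translate_sum a commute and
   square to zero on functions of total 0, so they have a common kernel vector. *)
Lemma common_kernel (r : seq F) : 0 \notin r ->
  #|S|%:R = lambda%:R :> K ->
  exists g : F -> K, [/\ exists x, g x != 0, \sum_x g x = 0
    & forall a, a \in r -> forall x, translate_sum a g x = 0].
Proof.
move=> + Sl; elim: r => [_ | a r IH].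
  (* With no operator to kill, any nonzero function of total 0 will do: here the point mass at 0
     minus the one at 1. *)
  exists (fun x => (x == 0)%:R - (x == 1)%:R); split=> //.
    by exists 0; rewrite eqxx (eq_sym 0 1) oner_eq0 subr0 oner_eq0.
  rewrite sumrB (bigD1 0) // big1 /= => [|x /negbTE ->] //.
  rewrite eqxx (bigD1 1) // big1 /= => [|x /negbTE ->] //.
  by rewrite eqxx subrr.
rewrite inE negb_or eq_sym => /andP[a0 /IH[g [[x gx] g0 gr]]].
case: (boolP [forall y, translate_sum a g y == 0]) => [/forallP Tg|].
  exists g; split=> //; first by exists x.
  move=> b; rewrite inE => /predU1P[-> y|]; last exact: gr.
  exact/eqP.
rewrite negb_forall => /existsP[y Ty].
exists (translate_sum a g); split; first by exists y.
  by rewrite translate_sum_total g0 mulr0.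
move=> b; rewrite inE => /predU1P[-> z|/gr br z].
  by rewrite translate_sum_sqr // g0 Sl subrr mulr0 mul0r addr0.
rewrite translate_sumC /translate_sum big1 // => s _; exact: br.
Qed.

(** Take [g] killed by every [translate_sum a] with [a != 0], and sum these operators at a point [x]
    where [g x != 0]. For fixed [s] in [S], [x + a * s] runs over all points except [x], so the
    inner sum is [- g x] because [g] has total 0. Hence [#|S| * g x = 0]. *)
Lemma reversible_diffset_card_eq0 :
  #|S|%:R = lambda%:R :> K -> #|S|%:R = 0 :> K.
Proof.
move=> Sl; have [|g [[x gx] g0 Tg]] := @common_kernel (enum [set~ 0]) _ Sl.
  by rewrite mem_enum !inE eqxx.
have: \sum_(a | a != 0) translate_sum a g x = 0.
  by apply: big1 => a a0; apply: Tg; rewrite mem_enum !inE.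
rewrite translate_sum_all.
under eq_bigr => s Ss.
  have s0 : s != 0 by apply: contraNneq S_neq0 => <-.
  have -> : \sum_(a | a != 0) g (x + a * s) = - g x.
    apply/eqP; rewrite eq_sym -subr_eq0 -opprD oppr_eq0; apply/eqP.
    rewrite -[RHS]g0 [RHS](reindex_inj (addrI x)).
    by rewrite [RHS](reindex_inj (mulIf s0)) [RHS](bigD1 0) //= mul0r addr0.
  over.
rewrite sumr_const mulNrn => /eqP; rewrite oppr_eq0 -[g x *+ _]mulr_natl mulf_eq0.
by rewrite (negbTE gx) orbF => /eqP.
Qed.

End ReversibleDifferenceSets.

(** * Cyclotomic classes as fibres of a power map *)

Section CyclotomicClasses.
Variables (F : finFieldType) (alpha : F) (d m : nat).
Hypotheses (d_gt0 : (0 < d)%N) (m_gt0 : (0 < m)%N).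
Hypothesis card_F : #|F| = (d * m).+1.
Hypothesis alpha_prim : (d * m).-primitive_root alpha.

Lemma prim_root_neq0 : alpha != 0.
Proof.
apply: contra_eq_neq (prim_expr_order alpha_prim) => ->.
by rewrite expr0n eq_sym muln_eq0 !eqn0Ngt d_gt0 m_gt0 oner_eq0.
Qed.

Lemma prim_root_log x : x != 0 -> exists t, x = alpha ^+ t.
Proof.
move=> x0; have xN : x ^+ (d * m) = 1.
  by apply: (mulfI x0); rewrite mulr1 -exprS -card_F expf_card.
by have [t ->] := prim_rootP alpha_prim xN; exists t.
Qed.

Lemma eq_prim_root_exprM i j :
  (alpha ^+ (i * m) == alpha ^+ (j * m)) = (i == j %[mod d]).
Proof.
by rewrite (eq_prim_root_expr alpha_prim) -!muln_modl eqn_pmul2r.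
Qed.

(** Since [alpha] has order [d * m], the element [alpha ^+ t] lies in the class exactly when [t] and
    [i] agree modulo [d], that is, when [t * m] and [i * m] agree modulo [d * m]. Membership becomes
    an equation compatible with products. *)
Lemma mem_cyc_class i x :
  (x \in cyc_class alpha d i) = (x ^+ m == alpha ^+ (i * m)).
Proof.
apply/imsetP/eqP => [[j _ ->] | xm].
  rewrite exprMn -!exprM mulnAC [X in _ * X]exprM.
  by rewrite (prim_expr_order alpha_prim) expr1n mulr1.
have x0 : x != 0.
  apply: contra_eq_neq xm => ->; rewrite expr0n eqn0Ngt m_gt0 eq_sym.
  by rewrite expf_neq0 // prim_root_neq0.
have [t xt] := prim_root_log x0.
move: xm; rewrite xt -exprM => /eqP; rewrite eq_prim_root_exprM => /eqP ti.
(* Adding a multiple of the order [d * m] keeps the power of [alpha] and makes the truncated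
   subtraction of [i] exact. *)
have le_i : (i <= t + i * (d * m))%N.
  by rewrite (leq_trans _ (leq_addl _ _)) // leq_pmulr // muln_gt0 d_gt0.
have /dvdnP[j Ej] : (d %| t + i * (d * m) - i)%N.
  by rewrite -eqn_mod_dvd // mulnCA -modnDmr modnMr addn0 ti.
have jlt : (j %% (d * m) < #|F|)%N.
  by rewrite card_F ltnS ltnW // ltn_mod muln_gt0 d_gt0.
exists (Ordinal jlt) => //=; apply/eqP.
rewrite [(alpha ^+ d) ^+ _](_ : _ = (alpha ^+ d) ^+ j); last first.
  by apply: expr_mod; rewrite exprAC (prim_expr_order alpha_prim) expr1n.
rewrite -exprM -exprD mulnC -Ej subnKC // (eq_prim_root_expr alpha_prim).
by rewrite -modnDmr modnMl addn0.
Qed.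

Lemma card_cyc_class i : #|cyc_class alpha d i| = m.
Proof.
(* Exponents below [#|F|] repeat elements; exponents below [m], the order of [alpha ^+ d], give an
   injective parametrization. *)
have -> : cyc_class alpha d i = [set alpha ^+ i * (alpha ^+ d) ^+ j | j : 'I_m].
  apply/setP => x; apply/imsetP/imsetP => [[j _ ->] | [j _ ->]].
    exists (Ordinal (ltn_pmod j m_gt0)) => //=; rewrite expr_mod //.
    by rewrite -exprM (prim_expr_order alpha_prim).
  have jlt : (j < #|F|)%N.
    by rewrite card_F ltnS (leq_trans (ltnW (ltn_ord j))) // leq_pmull.
  by exists (Ordinal jlt).
rewrite card_imset ?card_ord // => j1 j2 /eqP.
rewrite (inj_eq (mulfI (expf_neq0 i prim_root_neq0))) -!exprM.
rewrite (eq_prim_root_expr alpha_prim) -!muln_modr eqn_pmul2l // !modn_small //.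
by move/eqP/val_inj.
Qed.


End CyclotomicClasses.

(** * The partition of the class [S] into cosets of [E] *)

Section ClassPartition.
Variables (F : finFieldType) (alpha : F) (e f eps : nat).
Hypotheses (f_gt1 : (1 < f)%N) (eps_gt1 : (1 < eps)%N).
Hypotheses (eps_e : (eps %| e)%N) (eps_lt_e : (eps < e)%N).
Hypothesis card_F : #|F| = (e * f).+1.
Hypothesis alpha_prim : (e * f).-primitive_root alpha.

Local Notation m := (e %/ eps)%N.
Local Notation S := (cyc_class alpha eps 0).
Local Notation E := (cyc_class alpha e 0).
Local Notation D := (@class_partition F alpha e eps).

Let f_gt0 : (0 < f)%N. Proof. exact: ltnW. Qed.
Let eps_gt0 : (0 < eps)%N. Proof. exact: ltnW. Qed.
Let e_gt0 : (0 < e)%N. Proof. exact: leq_trans eps_lt_e. Qed.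
Let em : (eps * m = e)%N. Proof. by rewrite mulnC divnK. Qed.
Let m_gt0 : (0 < m)%N. Proof. by rewrite divn_gt0 // ltnW. Qed.
Let mf_gt0 : (0 < m * f)%N. Proof. by rewrite muln_gt0 m_gt0. Qed.
Let card_F' : #|F| = (eps * (m * f)).+1. Proof. by rewrite mulnA em. Qed.
Let alpha_prim' : (eps * (m * f)).-primitive_root alpha.
Proof. by rewrite mulnA em. Qed.
Let alpha_neq0 : alpha != 0.
Proof. exact: prim_root_neq0 e_gt0 f_gt0 alpha_prim. Qed.

Let mem_eps i x : (x \in cyc_class alpha eps i)
  = (x ^+ (m * f) == alpha ^+ (i * (m * f))).
Proof. exact: mem_cyc_class. Qed.

Let mem_e i x : (x \in cyc_class alpha e i) = (x ^+ f == alpha ^+ (i * f)).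
Proof. exact: mem_cyc_class. Qed.

Let memS x : (x \in S) = (x ^+ (m * f) == 1).
Proof. by rewrite mem_eps. Qed.

Let memE x : (x \in E) = (x ^+ f == 1).
Proof. by rewrite mem_e. Qed.

Let E_S x : x \in E -> x \in S.
Proof. by rewrite memE memS mulnC exprM => /eqP ->; rewrite expr1n. Qed.

Let S_neq0 : 0 \notin S.
Proof. by rewrite memS expr0n eqn0Ngt mf_gt0 eq_sym oner_eq0. Qed.

Let S_M (x y : F) : y \in S -> (x * y \in S) = (x \in S).
Proof. by rewrite !memS exprMn => /eqP ->; rewrite mulr1. Qed.

Let S_V (x : F) : (x^-1 \in S) = (x \in S).
Proof. by rewrite !memS exprVn invr_eq1. Qed.

(** The classes of order [eps] partition the nonzero elements; the sum of indicators can be inserted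
    directly into double counts. *)
Lemma sum_mem_eps_classes w :
  (\sum_(i < eps) (w \in cyc_class alpha eps i) = (w != 0)%R)%N.
Proof.
case: eqP => [-> | /eqP w0] /=.
  rewrite big1 // => i _; rewrite mem_eps expr0n eqn0Ngt mf_gt0 eq_sym.
  by rewrite (negbTE (expf_neq0 _ alpha_neq0)).
have [t ->] := prim_root_log card_F alpha_prim w0.
rewrite (bigD1 (Ordinal (ltn_pmod t eps_gt0))) //= mem_eps -exprM.
rewrite (eq_prim_root_exprM mf_gt0 alpha_prim') modn_mod eqxx big1 // => i.
rewrite mem_eps -exprM (eq_prim_root_exprM mf_gt0 alpha_prim') -val_eqE /=.
by rewrite (modn_small (ltn_ord i)) eq_sym => /negbTE ->.
Qed.

Lemma sum_mem_class_partition y : (\sum_(j < m) (y \in D j) = (y \in S))%N.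
Proof.
case: (boolP (y \in S)) => [Sy | nSy]; last first.
  rewrite big1 // => j _; apply/eqP; rewrite eqb0; apply: contra nSy.
  rewrite mem_e memS => /eqP yf; rewrite exprM exprAC yf -exprM.
  have -> : (eps * j * f * m = eps * m * f * j)%N by lia.
  by rewrite em exprM (prim_expr_order alpha_prim) expr1n.
have y0 : y != 0 by apply: contraTneq Sy => ->.
have [t yt] := prim_root_log card_F alpha_prim y0.
have /dvdnP[s ts] : (eps %| t)%N.
  move: Sy; rewrite yt mem_eps -exprM (eq_prim_root_exprM mf_gt0 alpha_prim').
  by rewrite mod0n.
(* For [y = alpha ^+ (s * eps)], membership in [D j] means that [eps * s] and [eps * j] agree modulo
   [e = eps * m], so [j] is the residue of [s] modulo [m]. *)
have Dj (j : 'I_m) : (y \in D j) = (j == (s %% m)%N :> nat).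
  rewrite mem_e yt -exprM (eq_prim_root_exprM f_gt0 alpha_prim) ts mulnC.
  rewrite -[in RHS](modn_small (ltn_ord j)) eq_sym.
  by rewrite -[RHS](eqn_pmul2l eps_gt0) !muln_modr em.
rewrite (bigD1 (Ordinal (ltn_pmod s m_gt0))) //= Dj eqxx big1 // => j.
by rewrite Dj -val_eqE => /negbTE /= ->.
Qed.

Lemma class_partition_disjoint i j : i != j -> [disjoint D i & D j].
Proof.
move=> ij; apply/pred0P => y /=; apply/negbTE/negP => /andP[yi yj].
have := sum_mem_class_partition y.
rewrite (bigD1 i) //= (bigD1 j) 1?eq_sym //= yi yj.
by case: (y \in S).
Qed.

Lemma class_partition_union : family_union D = S.
Proof.
apply/setP => y; have := sum_mem_class_partition y.
case: bigcupP => [[j _ Dy]|nD].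
  by rewrite (bigD1 j) //= Dy; case: (y \in S).
rewrite big1 => [|j _]; first by case: (y \in S).
by apply/eqP; rewrite eqb0; apply/negP => Dy; apply: nD; exists j.
Qed.

Lemma class_partition_family : disjoint_family #|F| f D.
Proof.
split=> // [j|j|i j]; last exact: class_partition_disjoint.
  apply/subsetP => x; rewrite mem_e !inE; apply: contraTneq => ->.
  by rewrite expr0n eqn0Ngt f_gt0 eq_sym expf_neq0.
exact: card_cyc_class e_gt0 f_gt0 card_F alpha_prim _.
Qed.

(** * Extension of [phi] from powers of [alpha] to all nonzero elements *)

Let div_alpha_S i w : (w / alpha ^+ i \in S) = (w \in cyc_class alpha eps i).
Proof.
have a0 : alpha ^+ (i * (m * f)) != 0 by rewrite expf_neq0.
rewrite memS mem_eps expr_div_n -exprM.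
by rewrite -[RHS](inj_eq (mulIf (invr_neq0 a0))) divff.
Qed.

(** This is [phi] with [alpha ^+ i] replaced by [z]; on nonzero [z] it depends only on the coset of
    [z] modulo [S]. *)
Definition ratio_count z : nat :=
  #|[set u in E | (u != 1) && ((u - 1) / z \in S)]|.

Lemma phi_ratio_count i : phi alpha e eps i = ratio_count (alpha ^+ i).
Proof.
have ai := expf_neq0 i alpha_neq0.
apply: eq_card => u; rewrite !inE; congr [&& _, _ & _].
apply/imsetP/idP => [[y Sy ->]|uS]; first by rewrite mulrAC divff ?mul1r.
by exists ((u - 1) / alpha ^+ i) => //; rewrite mulrC divfK.
Qed.

Lemma ratio_countM z s : s \in S -> ratio_count (z * s) = ratio_count z.
Proof.
move=> Ss; apply: eq_card => u; rewrite !inE; congr [&& _, _ & _].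
by rewrite invfM mulrA S_M ?S_V.
Qed.

Lemma ratio_count_classE z i : z \in cyc_class alpha eps i ->
  ratio_count z = phi alpha e eps i.
Proof.
have ai := expf_neq0 i alpha_neq0.
move=> zi; rewrite phi_ratio_count.
rewrite -(ratio_countM (alpha ^+ i) (s := z / alpha ^+ i)).
  by rewrite mulrC divfK.
by rewrite div_alpha_S.
Qed.

Lemma ratio_countP z : z != 0 ->
  exists2 i, (i < eps)%N & ratio_count z = phi alpha e eps i.
Proof.
move=> z0; have := sum_mem_eps_classes z; rewrite z0.
case: (boolP [exists i : 'I_eps, z \in cyc_class alpha eps i]).
  by move=> /existsP[i zi] _; exists i => //; apply: ratio_count_classE.
rewrite negb_exists => /forallP nz; rewrite big1 // => i _.
by rewrite (negbTE (nz i)).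
Qed.

(** Inversion on [E] exchanges the two counted sets: [u^-1 - 1 = - (u - 1) / u], and dividing by
    [u], an element of [S], does not change the coset modulo [S]. *)
Lemma ratio_countN z : ratio_count (- z) = ratio_count z.
Proof.
pose A z := [set u in E | (u != 1) && ((u - 1) / z \in S)].
have A_V t u : u \in A t -> u^-1 \in A (- t).
  rewrite !inE => /and3P[Eu u1 uS].
  have u0 : u != 0.
    by apply: contraTneq Eu => ->; apply: contra S_neq0; apply: E_S.
  rewrite memE exprVn invr_eq1 -memE Eu invr_eq1 u1 /=.
  have -> : (u^-1 - 1) / - t = (u - 1) / t * u^-1.
    rewrite invrN mulrN -mulNr opprB mulrAC; congr (_ / _).
    by rewrite mulrBl mul1r divff.
  by rewrite S_M // S_V E_S.
rewrite /ratio_count -(card_imset _ (@invr_inj F)); apply: eq_card => u.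
apply/imsetP/idP => [[v /A_V + ->] | uA]; first by rewrite opprK.
by exists u^-1; rewrite ?invrK //; apply: A_V.
Qed.

(** Each of the [f - 1] elements [u != 1] of [E] has [u - 1] nonzero, hence in exactly one class of
    order [eps]. *)
Lemma sum_phi : (\sum_(i < eps) phi alpha e eps i = f - 1)%N.
Proof.
have E1 : 1 \in E by rewrite memE expr1n.
have cE : #|E| = f by apply: card_cyc_class.
rewrite -[in RHS]cE (cardsD1 1) E1 add1n subn1 /= -sum1_card.
transitivity
  (\sum_(u in E :\ 1%R) \sum_(i < eps) (u - 1 \in cyc_class alpha eps i)%R)%N.
  rewrite exchange_big /=; apply: eq_bigr => i _.
  rewrite phi_ratio_count /ratio_count -sum1_card big_mkcond [RHS]big_mkcond /=.
  apply: eq_bigr => u _; rewrite !inE div_alpha_S.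
  by case: (u \in E); case: (u == 1); case: (u - 1 \in _).
apply: eq_bigr => u; rewrite !inE sum_mem_eps_classes subr_eq0.
by case/andP=> ->.
Qed.

(** For [y] in [D j], the element [y + z] is again in [D j] exactly when the ratio [u = 1 + z / y]
    lies in [E]. Summing over [j] lets [y] range over [S], and then [u - 1 = z / y] ranges over
    [z S]. *)
Lemma internal_count z : z != 0 ->
  (\sum_(j < m) diff_count (D j) (D j) z)%N = ratio_count z.
Proof.
move=> z0; pose A := [set y in S | 1 + z / y \in E].
have -> : ratio_count z = #|A|.
  (* The ratio [u] determines [y = z / (u - 1)], so counting [u] and counting [y] agree. *)
  have -> : ratio_count z = #|[set 1 + z / y | y in A]|.
    apply: eq_card => u; rewrite !inE; apply/and3P/imsetP => [[Eu u1 uS]|[y]].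
      have u10 : u - 1 != 0 by rewrite subr_eq0.
      have zu : 1 + z / (z / (u - 1)) = u.
        by rewrite invf_div mulrCA divff // mulr1 addrC subrK.
      by exists (z / (u - 1)); rewrite ?inE zu // -S_V invf_div uS.
    rewrite !inE => /andP[Sy Ey ->].
    have y0 : y != 0 by apply: contraTneq Sy => ->.
    split=> //; last by rewrite addrC addKr mulrAC divff // mul1r S_V.
    by rewrite -subr_eq0 addrC addKr mulf_neq0 ?invr_eq0.
  apply: card_in_imset => x y _ _ /addrI /(mulfI z0); exact: invr_inj.
rewrite -sum1_card [RHS]big_mkcond /=.
transitivity (\sum_y \sum_(j < m) (y \in D j) * (1 + z / y \in E)%R)%N.
  rewrite exchange_big; apply: eq_bigr => j _.
  rewrite /diff_count -sum1_card big_mkcond; apply: eq_bigr => y _.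
  rewrite inE; case: (boolP (y \in D j)) => //= Dy.
  have -> : (y + z \in D j) = (1 + z / y \in E).
    have y0 : y != 0.
      apply: contraTneq Dy => ->; rewrite mem_e expr0n eqn0Ngt f_gt0 eq_sym.
      by rewrite expf_neq0.
    move: Dy; rewrite !mem_e mul0n expr0 => /eqP yf.
    have -> : y + z = y * (1 + z / y).
      by rewrite mulrDr mulr1 mulrCA divff // mulr1.
    rewrite exprMn yf -{2}[alpha ^+ _]mulr1.
    by apply/inj_eq/mulfI; rewrite expf_neq0.
  by case: (_ \in E).
apply: eq_bigr => y _; rewrite -big_distrl /= sum_mem_class_partition inE.
by case: (y \in S); case: (_ \in E).
Qed.

Lemma diff_count_class_partition z :
  (\sum_(i < m) \sum_(j < m) diff_count (D i) (D j) z)%N = diff_count S S z.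
Proof.
have ind D1 D2 : diff_count D1 D2 z = (\sum_y (y \in D2) * (y + z \in D1)%R)%N.
  rewrite /diff_count -sum1_card big_mkcond; apply: eq_bigr => y _.
  by rewrite inE; case: (y \in D2); case: (_ \in D1).
under eq_bigr do under eq_bigr do rewrite ind.
under eq_bigr do rewrite exchange_big /=.
rewrite exchange_big ind; apply: eq_bigr => y _.
rewrite exchange_big -!sum_mem_class_partition big_distrl /=.
by apply: eq_bigr => j _; rewrite big_distrr.
Qed.

Lemma count_mem_internal z :
  count_mem z (internal_diffs D) = ((z != 0)%R * ratio_count z)%N.
Proof.
rewrite count_mem_bigcat; under eq_bigr do rewrite count_mem_Delta.
by rewrite -big_distrr /=; case: eqP => //= /eqP z0; rewrite internal_count.
Qed.

(** Internal and external pairs together are all pairs from [S]. The additive form avoids truncated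
    subtraction. *)
Lemma count_mem_external z : z != 0 ->
  (ratio_count z + count_mem z (external_diffs D) = diff_count S S z)%N.
Proof.
move=> z0; rewrite count_mem_bigcat -internal_count // -big_split /=.
rewrite -diff_count_class_partition; apply: eq_bigr => i _.
rewrite count_mem_bigcat [RHS](bigD1 i) //=; congr addn.
apply: eq_big => [j|j _]; first by rewrite eq_sym.
exact: count_mem_Delta2.
Qed.

Lemma count_mem_external0 : count_mem 0 (external_diffs D) = 0%N.
Proof.
rewrite count_mem_bigcat big1 // => i _; rewrite count_mem_bigcat big1 // => j ij.
rewrite count_mem_Delta2; apply: eq_card0 => y; rewrite !inE addr0.
by have /pred0P/(_ y) := class_partition_disjoint ij; rewrite /= andbC.
Qed.

(** * Consequences of [S] being a difference set *)

Variable lambda : nat.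
Hypothesis S_diff : forall z : F, z != 0 -> diff_count S S z = lambda.

Let card_S : #|S| = (m * f)%N. Proof. exact: card_cyc_class. Qed.

(** Counting ordered pairs from [S] gives [k ^ 2 = k + lambda * (eps * k)] with [k = m * f], because
    there are [eps * k] nonzero elements; then [k] cancels. *)
Lemma card_classE : (m * f = 1 + lambda * eps)%N.
Proof.
have := sum_diff_count S S; rewrite (bigD1 0) //= diff_count0.
under eq_bigr => z z0 do rewrite S_diff //.
rewrite sum_nat_const; have -> : #|[pred z : F | z != 0]| = (eps * (m * f))%N.
  rewrite -[RHS]/((eps * (m * f)).+1.-1) -card_F' -(cardC1 (0 : F)).
  exact: eq_card.
rewrite card_S => H; apply/eqP; rewrite -(eqn_pmul2l mf_gt0) -H.
by rewrite mulnDr muln1; apply/eqP; lia.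
Qed.

Let lambda_gt0 : (0 < lambda)%N.
Proof.
have := card_classE; case: (posnP lambda) => // ->.
have : (1 < m * f)%N by rewrite (leq_trans f_gt1) // leq_pmull.
by move=> + E1; rewrite E1.
Qed.

(** Here [n = #|S| - lambda] exceeds 1, so it has a prime divisor [p]. Modulo [p] the size of [S]
    equals [lambda], and symmetry would make it vanish; then [p] divides both [lambda] and
    [n = 1 + lambda * (eps - 1)], hence 1. *)
Lemma power_residue_not_reversible : ~ forall x, (- x \in S) = (x \in S).
Proof.
move=> S_opp; pose n := (1 + lambda * (eps - 1))%N.
have kn : (m * f = n + lambda)%N.
  by rewrite card_classE /n -addnA -{3}[lambda]muln1 -mulnDr subnK.
have n_gt1 : (1 < n)%N by rewrite /n add1n ltnS muln_gt0 lambda_gt0 subn_gt0.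
pose p := pdiv n; have p_pr : prime p by apply: pdiv_prime.
have natF k : ((k%:R : 'F_p) == 0) = (p %| k)%N.
  by rewrite -(dvdn_pcharf (pchar_Fp p_pr)).
have n0 : n%:R = 0 :> 'F_p by apply/eqP; rewrite natF pdiv_dvd.
have := @reversible_diffset_card_eq0 F 'F_p S lambda S_neq0 S_opp S_diff.
rewrite card_S kn natrD n0 add0r => /(_ erefl)/eqP; rewrite natF => p_l.
have : (p %| n)%N by apply: pdiv_dvd.
rewrite /n dvdn_addl ?dvdn_mulr // dvdn1 => /eqP p1.
by rewrite p1 in p_pr.
Qed.

(* A difference multiset is symmetric; so if only the class S had its own
   multiplicity, S would be closed under negation. *)
Lemma phi0_eq c :
  (forall i, (0 < i < eps)%N -> phi alpha e eps i = c) -> phi alpha e eps 0 = c.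
Proof.
move=> phi_c; apply/eqP/negPn/negP => phi0.
apply: power_residue_not_reversible.
have S0 x : x != 0 -> (x \in S) = (ratio_count x == phi alpha e eps 0).
  move=> x0; apply/idP/eqP => [/ratio_count_classE // | Ex].
  have := sum_mem_eps_classes x; rewrite x0.
  rewrite (bigD1 (Ordinal eps_gt0)) //=; case: (x \in S) => //.
  rewrite big1 // => i; rewrite -val_eqE /= -lt0n => i_gt0.
  apply/eqP; rewrite eqb0; apply: contra phi0 => /ratio_count_classE.
  by rewrite Ex => ->; rewrite phi_c // i_gt0 ltn_ord.
move=> x; have [-> | x0] := eqVneq x 0; first by rewrite oppr0.
by rewrite !S0 ?oppr_eq0 // ratio_countN.
Qed.

Lemma alpha_notin_S i : (0 < i < eps)%N -> alpha ^+ i \notin S.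
Proof.
case/andP=> i0 ie; rewrite mem_eps -exprM (eq_prim_root_exprM mf_gt0 alpha_prim').
by rewrite mod0n modn_small // -lt0n.
Qed.

(** The value off [S] is read at [alpha ^+ i] with [0 < i < eps], the value on [S] at
    [alpha ^+ 0 = 1]; [phi0_eq] identifies them. *)
Lemma phi_eq_of_partial c c' :
  (forall z, z != 0 -> ratio_count z = if z \in S then c else c') ->
  (forall i, (0 < i < eps)%N -> phi alpha e eps i = c') /\ c = c'.
Proof.
move=> rc; have phi_c i : (0 < i < eps)%N -> phi alpha e eps i = c'.
  move=> ie; rewrite phi_ratio_count rc ?expf_neq0 //.
  by rewrite (negbTE (alpha_notin_S ie)).
split=> //; rewrite -(phi0_eq phi_c) phi_ratio_count rc ?expf_neq0 //.
by rewrite memS expr1n eqxx.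
Qed.

Lemma dpdf_phi k c c' : dpdf_with #|F| k c c' D ->
  (forall i, (0 < i < eps)%N -> phi alpha e eps i = c') /\ c = c'.
Proof.
case=> _ /perm_eq_count_mem cnt; apply: phi_eq_of_partial => z z0.
have := cnt z; rewrite count_mem_partial // count_mem_internal z0 mul1n.
by rewrite class_partition_union.
Qed.

Lemma epdf_phi k c c' : epdf_with #|F| k c c' D ->
  (forall i, (0 < i < eps)%N -> phi alpha e eps i = (lambda - c')%N) /\ c = c'.
Proof.
case=> _ /perm_eq_count_mem cnt.
have rc z : z != 0 -> (ratio_count z + (if z \in S then c else c') = lambda)%N.
  move=> z0; have := cnt z; rewrite count_mem_partial // class_partition_union.
  by move=> <-; rewrite count_mem_external // S_diff.
have [phi_c cc'] : (forall i, (0 < i < eps)%N ->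
    phi alpha e eps i = (lambda - c')%N) /\ (lambda - c = lambda - c')%N.
  apply: phi_eq_of_partial => z z0; have := rc z z0.
  by case: (z \in S) => <-; rewrite addnK.
(* Equality of the truncated differences [lambda - c] and [lambda - c'] gives [c = c'] once both are
   at most [lambda], which [rc] shows at 1 (in [S]) and at [alpha] (outside [S]). *)
split=> //; have := rc 1 (oner_neq0 F); rewrite memS expr1n eqxx.
have := rc _ (expf_neq0 1 alpha_neq0).
rewrite (negbTE (alpha_notin_S _)) ?eps_gt1 //; lia.
Qed.

(** By [phi0_eq] all [eps] numbers [phi] equal [c], so [sum_phi] gives [eps * c = f - 1]. Every
    nonzero element then has internal multiplicity [c] and external multiplicity [lambda - c]. *)
Lemma constant_phi c : (forall i, (0 < i < eps)%N -> phi alpha e eps i = c) ->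
  [/\ (eps * c = f - 1)%N, disjoint_difference_family #|F| f c D,
      (c <= lambda)%N & external_difference_family #|F| f (lambda - c) D].
Proof.
move=> phi_c; have phi0 := phi0_eq phi_c.
have rc z : z != 0 -> ratio_count z = c.
  by move=> /ratio_countP[[|i] ie ->] //; apply: phi_c.
split.
- rewrite -sum_phi (eq_bigr (fun=> c)) ?sum_nat_const ?card_ord //.
  by move=> [[|i] ie] _ //; apply: phi_c.
- split; first exact: class_partition_family.
  apply/perm_eq_count_mem => z; rewrite count_mem_internal count_mem_copies !inE.
  by case: eqP => [|/eqP/rc ->]; rewrite ?muln0 // mulnC.
- rewrite -(rc 1) ?oner_neq0 // -(S_diff (oner_neq0 F)).
  by rewrite -count_mem_external ?oner_neq0 // leq_addr.
- split; first exact: class_partition_family.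
  apply/perm_eq_count_mem => z; rewrite count_mem_copies !inE.
  have [-> | z0] := eqVneq z 0; first by rewrite count_mem_external0 muln0.
  by rewrite muln1 -(S_diff z0) -count_mem_external // rc // addKn.
Qed.

End ClassPartition.

(* Assembly of the theorem and the arithmetic of its parameters *)
Local Close Scope ring_scope.

Theorem theorem5p1 (F : finFieldType) (alpha : F) (q e f epsilon lambda : nat)
  (hF : #|F| = q)
  (hq : q = e * f + 1)
  (he : 1 < e) (hf : 1 < f)
  (halpha : ((q - 1)%N.-primitive_root alpha)%R)
  (heps1 : 1 < epsilon) (hepse : epsilon %| e) (hepslt : epsilon < e)
  (hD : difference_set q ((q - 1) %/ epsilon) lambda
          (cyc_class alpha epsilon 0)) :
  let D := @class_partition F alpha e epsilon in
  let differing := exists i j : nat,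
    [/\ 1 <= i <= epsilon - 1, 1 <= j <= epsilon - 1, i <> j
      & phi alpha e epsilon i <> phi alpha e epsilon j] in
  [/\ lambda * epsilon ^ 2 = q - 1 - epsilon,
      differing ->
        ~ disjoint_partial_difference_family D /\
        ~ external_partial_difference_family D,
      ~ differing ->
        [/\ epsilon %| f - 1,
            disjoint_difference_family q f ((f - 1) %/ epsilon) D,
            epsilon ^ 2 %| (e - epsilon) * f
          & external_difference_family q f
              ((e - epsilon) * f %/ epsilon ^ 2) D]
    & ~ proper_dpdf D /\ ~ proper_epdf D].
Proof.
move=> D differing.
have q1 : q - 1 = e * f by rewrite hq addnK.
have card_F : #|F| = (e * f).+1 by rewrite hF hq addn1.
rewrite q1 in halpha hD *.
have S_diff (z : F) : (z != 0)%R ->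
    diff_count (cyc_class alpha epsilon 0) (cyc_class alpha epsilon 0) z = lambda.
  case: hD => _ _ /perm_eq_count_mem/(_ z) + z0.
  by rewrite count_mem_Delta count_mem_copies !inE z0 mul1n muln1.
have cE := card_classE hf heps1 hepse hepslt card_F halpha S_diff.
have em : epsilon * (e %/ epsilon) = e by rewrite mulnC divnK.
(* This is [card_classE] multiplied by [epsilon], in subtraction-free form. *)
have lam : lambda * epsilon ^ 2 + epsilon = e * f.
  by rewrite -{1}em -mulnA cE; lia.
have rng i : (1 <= i <= epsilon - 1) = (0 < i < epsilon).
  by case: i => // i; rewrite leq_subRL ?add1n // ltnW.
split.
- by rewrite -lam addnK.
- move=> [i [j [+ + _ neq_phi]]]; rewrite !rng => i_rng j_rng.
  split=> -[k [c [c']]].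
    move=> /(dpdf_phi hf heps1 hepse hepslt card_F halpha S_diff)[phi_c _].
    by apply: neq_phi; rewrite !phi_c.
  move=> /(epdf_phi hf heps1 hepse hepslt card_F halpha S_diff)[phi_c _].
  by apply: neq_phi; rewrite !phi_c.
(* The index 1 is in range because [epsilon > 1], so [phi] at 1 serves as the common value. *)
- move=> not_diff; pose c := phi alpha e epsilon 1.
  have phi_c i : 0 < i < epsilon -> phi alpha e epsilon i = c.
    move=> i_rng; apply/eqP/negPn/negP => /eqP neq; apply: not_diff.
    exists i, 1; rewrite !rng; split=> // i1.
    by apply: neq; rewrite i1.
  have [cf ddf c_le edf] :=
    constant_phi hf heps1 hepse hepslt card_F halpha S_diff phi_c.
  (* Substitute [e * f = lambda * epsilon ^ 2 + epsilon] and [f = 1 + epsilon * c]; the two terms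
     [epsilon] cancel. *)
  have lc : (e - epsilon) * f = epsilon ^ 2 * (lambda - c).
    by rewrite mulnBl -lam mulnBr; nia.
  have eps_gt0 : 0 < epsilon by apply: ltnW.
  rewrite -cf lc dvdn_mulr // dvdn_mulr // mulKn // mulKn ?expn_gt0 ?eps_gt0 //.
  by rewrite -hF; split.
- split=> -[k [c [c' [neq]]]].
    by move=> /(dpdf_phi hf heps1 hepse hepslt card_F halpha S_diff)[_].
  by move=> /(epdf_phi hf heps1 hepse hepslt card_F halpha S_diff)[_].
Qed.
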